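(* Let $q=p^k$ be a prime power with $k$ odd and $q\equiv 1 \pmod 4$. Let $s=s(q)$ denote the maximal cardinality of a set $B\subset \mathbb{F}_q$ such that every element of the difference set $B-B=\{b_1-b_2: b_1,b_2\in B\}$ is a square in $\mathbb{F}_q$. Then: (i) if $\lfloor\sqrt{q}\rfloor$ is even, then $s^2+s-1\leq q$; (ii) if $\lfloor\sqrt{q}\rfloor$ is odd, then $s^2+2s-2\leq q$.
   Context: $\lfloor x\rfloor$ denotes the integer part of $x$. Here $0$ counts as a square (so $0=b-b\in B-B$ is allowed). *)

(* Defs.v *)
From mathcomp Require Import all_boot all_order all_algebra all_field.
From mathcomp Require Import reals.

Set Implicit Arguments.
Unset Strict Implicit.
Unset Printing Implicit Defensive.

Import Order.TTheory GRing.Theory Num.Theory.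
Local Open Scope ring_scope.

(* Zero is a square. *)
Definition is_square (F : finFieldType) (x : F) : bool :=
  [exists y : F, x == y ^+ 2].

Definition diff_set (F : finFieldType) (B : {set F}) : {set F} :=
  [set b1 - b2 | b1 in B, b2 in B].

Definition square_diffs (F : finFieldType) (B : {set F}) : bool :=
  [forall x in diff_set B, is_square x].

(* The maximum is over a nonempty family, since set0 satisfies square_diffs. *)
Definition max_square_diffs (F : finFieldType) : nat :=
  \max_(B : {set F} | square_diffs B) #|B|.

(* The integer part of the real square root; truncn is the floor on x >= 0. *)
Definition floor_sqrt (R : realType) (q : nat) : nat :=
  Num.truncn (Num.sqrt (q%:R : R)).

(* Main.v *)
(** Stepanov's method, following Hanson-Petridis and Yip.  Let [N = |B|],
    [K = (q - 1) / 2], pick distinct points [a_0, .., a_n] of [B] and weights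
    [c_i] with [\sum_i c_i a_i ^ l = [l = n]] for [l <= n].  Since nonzero
    differences in [B] have [K]-th power 1, the polynomial
    [\sum_i c_i (a_i - X) ^ (K + n) - 1] vanishes to order [n] at each point of
    [B], and to order [n + 1] at those other than the [a_i], while its degree is
    at most [K]; it is nonzero as soon as ['C(K + n, n)] is invertible in [F].
    Counting zeros, [(n + 1) (N - 1) <= K].

    By Lucas, [n = d p ^ m] is admissible when [q = p ^ (2 m + 1)] and
    [d <= (p - 1) / 2].  For [m = 0] this gives [2 N (N - 1) < p], which implies
    both bounds except that (ii) would fail for [N = 2], [q = 5], where the
    integer part of the square root is even.  For [m > 0], choosing [d] with
    [d ^ 2 < p <= (d + 1) ^ 2] gives [N <= d p ^ m], whence
    [(N + 1) ^ 2 <= q]. *)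

Require Import Defs.
From mathcomp Require Import all_boot all_order all_algebra all_field.
From mathcomp Require Import reals.
From mathcomp Require Import zify.

Set Implicit Arguments.
Unset Strict Implicit.
Unset Printing Implicit Defensive.

Import Order.TTheory GRing.Theory Num.Theory.

Local Open Scope ring_scope.

(** * Coefficients of binomial powers and Lucas's congruence *)

Lemma coef_polyC_subX_exp (R : comNzRingType) (u : R) (n l : nat) :
  ((u%:P - 'X) ^+ n)`_l = (-1) ^+ l * u ^+ (n - l) *+ 'C(n, l).
Proof.
rewrite exprBn coef_sum.
have coefE i : (((-1) ^+ i * u%:P ^+ (n - i) * 'X^i) *+ 'C(n, i))`_l =
    if i == l then (-1) ^+ i * u ^+ (n - i) *+ 'C(n, i) else 0.
  rewrite coefMn -polyC_exp -[-1](rmorphN1 (polyC : {rmorphism R -> {poly R}})).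
  rewrite -polyC_exp -polyCM coefCM coefXn eq_sym.
  by case: eqP => _; rewrite ?mulr1 // mulr0 mul0rn.
under eq_bigr => i _ do rewrite coefE.
rewrite -big_mkcond /=.
have [l_le|l_gt] := leqP l n; last first.
  by rewrite bin_small // mulr0n big_pred0 // => i; apply: ltn_eqF; have := ltn_ord i; lia.
by rewrite (big_pred1 (Ordinal (n := n.+1) l_le)).
Qed.

Lemma coef_addX1_exp (R : comNzRingType) (n l : nat) :
  ((1 + 'X : {poly R}) ^+ n)`_l = 'C(n, l)%:R.
Proof.
rewrite exprDn coef_sum.
under eq_bigr => i _ do rewrite expr1n mul1r coefMn coefXn.
have [l_le|l_gt] := leqP l n; last first.
  rewrite bin_small // big1 // => i _.
  by rewrite gtn_eqF ?mul0rn //; have := ltn_ord i; lia.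
rewrite (bigD1 (Ordinal (n := n.+1) l_le)) //= eqxx big1 ?addr0 // => i ne_il.
by rewrite (_ : (l == i) = false) ?mul0rn // eq_sym; apply: negbTE.
Qed.

(** Compare coefficients of [X^(dP)] in [(1 + X)^(aP + h) = (1 + X^P)^a (1 + X)^h]: as [h < P], only
    the constant term of the last factor contributes. *)
Lemma lucas_step (R : comNzRingType) (P a d h : nat) :
  [pchar R]%R.-nat P -> (h < P)%N ->
  'C(a * P + h, d * P)%:R = 'C(a, d)%:R :> R.
Proof.
move=> charP h_lt; rewrite -coef_addX1_exp exprD mulnC exprM.
rewrite exprDn_pchar; last by rewrite (eq_pnat _ (pchar_poly R)).
rewrite expr1n exprDn mulr_suml coef_sum.
have coefE i : (1 ^+ (a - i) * 'X^P ^+ i *+ 'C(a, i) * (1 + 'X) ^+ h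
    : {poly R})`_(d * P) = if i == d then 'C(a, i)%:R else 0.
  rewrite expr1n mul1r mulrnAl coefMn -exprM mulrC coefMXn.
  rewrite [(P * i)%N]mulnC ltn_pmul2r ?(leq_ltn_trans _ h_lt) //.
  case: ltngtP => [_|lt_id|->]; rewrite ?mul0rn //.
    rewrite coef_addX1_exp -mulnBl bin_small ?mul0rn //.
    by rewrite (leq_trans h_lt) // leq_pmull // subn_gt0.
  by rewrite subnn coef_addX1_exp bin0.
under eq_bigr => i _ do rewrite coefE.
rewrite -big_mkcond /=.
have [d_le|d_gt] := leqP d a; last first.
  by rewrite bin_small // big_pred0 // => i; apply: ltn_eqF; have := ltn_ord i; lia.
by rewrite (big_pred1 (Ordinal (n := a.+1) d_le)).
Qed.

(** * Multiplicities of roots *)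

Lemma dvdp_XsubC_exp (F : fieldType) (f : {poly F}) (b : F) (e : nat) :
  (forall l, (l < e)%N -> (f \Po ('X + b%:P))`_l = 0) ->
  ('X - b%:P) ^+ e %| f.
Proof.
(* Translation by [b] reduces the claim to divisibility by ['X^e]. *)
move=> low0; rewrite -(comp_Xn_poly ('X - b%:P)) -[f in _ %| f](comp_polyXaddC_K _ b).
apply: dvdp_comp_poly; rewrite -[X in _ %| X](poly_take_drop e).
rewrite [take_poly _ _](_ : _ = 0) ?add0r ?dvdp_mulIr //.
by apply/polyP => i; rewrite coef_take_poly coef0; case: ltnP => // /low0.
Qed.

(** Powers of distinct linear factors are coprime, so their product divides [f]. *)
Lemma sum_multiplicities (F : fieldType) (s : seq F) (e : F -> nat)
    (f : {poly F}) :
  uniq s -> f != 0 -> (forall b, b \in s -> ('X - b%:P) ^+ e b %| f) ->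
  (\sum_(b <- s) e b < size f)%N.
Proof.
move=> uniq_s f_neq0 dvd_f.
have prod_dvd : \prod_(b <- s) ('X - b%:P) ^+ e b %| f.
  elim: s uniq_s dvd_f => [|b s IHs] /=; first by rewrite big_nil dvd1p.
  case/andP=> b_notin uniq_s dvd_f; rewrite big_cons Gauss_dvdp.
    rewrite dvd_f ?mem_head // IHs // => c cs.
    by apply: dvd_f; rewrite inE cs orbT.
  apply: coprimep_expl; rewrite coprimep_sym coprimep_XsubC rootE horner_prod.
  rewrite prodf_seq_neq0; apply/allP => c cs /=.
  rewrite horner_exp hornerXsubC expf_neq0 // subr_eq0.
  by apply: contraNneq b_notin => ->.
have prod_neq0 t : \prod_(b <- t) ('X - b%:P) ^+ e b != 0.
  by apply/monic_neq0/monic_prod => b _; rewrite monic_exp ?monicXsubC.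
have size_prod t :
    size (\prod_(b <- t) ('X - b%:P) ^+ e b) = (\sum_(b <- t) e b).+1.
  elim: t => [|b t IHt]; first by rewrite !big_nil size_poly1.
  rewrite !big_cons size_monicM ?monic_exp ?monicXsubC //.
  by rewrite size_exp_XsubC IHt addSn addnS.
by rewrite -size_prod dvdp_leq.
Qed.

(** * Weights with prescribed power moments *)

Section MomentWeights.

Variables (F : fieldType) (n : nat) (a : 'I_n.+1 -> F).
Hypothesis a_inj : injective a.

(** The weights form the last column of the inverse of a Vandermonde matrix, invertible because the
    [a i] are distinct. *)
Lemma moment_weights : exists c : 'I_n.+1 -> F,
  forall l, (l <= n)%N -> \sum_i c i * a i ^+ l = (l == n)%:R.
Proof.
pose V := Vandermonde n.+1 (\row_i a i).
have V_unit : V \in unitmx.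
  rewrite unitmxE det_Vandermonde unitfE; apply/prodf_neq0 => i _.
  apply/prodf_neq0 => j lt_ij; rewrite !mxE subr_eq0 (inj_eq a_inj).
  by rewrite -val_eqE /= gtn_eqF.
pose c : 'cV[F]_n.+1 := invmx V *m delta_mx ord_max 0.
exists (fun i => c i 0) => l l_le.
have /matrixP/(_ (Ordinal (n := n.+1) l_le) 0) :=
  mulKVmx V_unit (delta_mx ord_max 0 : 'cV[F]_n.+1).
rewrite -/c !mxE eqxx andbT -val_eqE /= => <-.
by apply: eq_bigr => i _; rewrite !mxE mulrC.
Qed.

(** In the expansion of [(a i - x) ^ l], every term but [a i ^ l] involves a moment of order below
    [n], which vanishes. *)
Lemma moment_weights_shift (c : 'I_n.+1 -> F) (x : F) :
  (forall l, (l <= n)%N -> \sum_i c i * a i ^+ l = (l == n)%:R) ->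
  forall l, (l <= n)%N -> \sum_i c i * (a i - x) ^+ l = (l == n)%:R.
Proof.
move=> cP l l_le.
under eq_bigr => i _ do rewrite exprBn mulr_sumr.
rewrite exchange_big big_ord_recl /= [X in _ + X]big1 => [|j _].
  by rewrite subn0 addr0 -cP //; apply: eq_bigr => i _;
    rewrite expr0 mul1r mulr1 bin0.
transitivity ((\sum_i c i * a i ^+ (l - j.+1)) *
    ((-1) ^+ j.+1 * x ^+ j.+1 *+ 'C(l, j.+1))).
  rewrite mulr_suml; apply: eq_bigr => i _.
  rewrite /bump /= add1n mulrnAr [RHS]mulrnAr -!mulrA; congr (_ * _ *+ _).
  by rewrite mulrCA.
have lt_jl := ltn_ord j.
by rewrite cP ?ltn_eqF ?mul0r //; lia.
Qed.

End MomentWeights.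

(** * The Stepanov polynomial *)

Lemma square_exp_half (F : finFieldType) (x : F) :
  odd #|F| -> is_square x -> x != 0 -> x ^+ (#|F|.-1./2) = 1.
Proof.
move=> oddF /existsP[y /eqP->]; rewrite expf_eq0 /= => y_neq0.
rewrite -exprM; apply: (mulIf y_neq0).
rewrite mul1r -exprSr -[RHS]expf_card; congr (_ ^+ _).
have : (1 < #|F|)%N by exact: finNzRing_gt1.
by move: oddF; move: #|F| => N; lia.
Qed.

Lemma clique_stepanov (F : finFieldType) (B : {set F}) (n : nat) :
  odd #|F| -> square_diffs B -> (n < #|B|)%N ->
  'C(#|F|.-1./2 + n, n)%:R != 0 :> F ->
  (n.+1 * #|B|.-1 <= #|F|.-1./2)%N.
Proof.
set K := #|F|.-1./2 => oddF sqB n_lt bin_neq0.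
have card_gt2 : (2 < #|F|)%N.
  have : (1 < #|F|)%N by exact: finNzRing_gt1.
  by case: #|F| oddF => [|[|[|N]]].
have K_gt0 : (0 < K)%N by rewrite half_gt0 ltn_predRL.
pose a (i : 'I_n.+1) := nth 0 (enum B) i.
have sz i : (i < n.+1)%N -> (i < size (enum B))%N.
  by rewrite -cardE => /leq_trans; apply.
have a_inj : injective a.
  move=> i j /eqP; rewrite nth_uniq ?enum_uniq ?sz // => /eqP; exact: val_inj.
have aB i : a i \in B by rewrite -mem_enum mem_nth ?sz.
pose A := [set a i | i : 'I_n.+1].
have cardA : #|A| = n.+1 by rewrite card_imset // card_ord.
have subAB : A \subset B by apply/subsetP => _ /imsetP[i _ ->].
have [c cP] := moment_weights a_inj.
pose f : {poly F} := \sum_i c i *: ((a i)%:P - 'X) ^+ (K + n) - 1.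
(* These coefficients are the Hasse derivatives of f at b, so they detect
   multiplicities in characteristic p. *)
have coef_shift b l : (f \Po ('X + b%:P))`_l =
    (-1) ^+ l * (\sum_i c i * (a i - b) ^+ (K + n - l)) *+ 'C(K + n, l)
    - (l == 0%N)%:R.
  rewrite /f comp_polyB rmorph1 coefB coef1 raddf_sum coef_sum; congr (_ - _).
  rewrite mulr_sumr -sumrMnl; apply: eq_bigr => i _.
  rewrite /= comp_polyZ coefZ /= rmorphXn /= comp_polyB comp_polyX comp_polyC.
  rewrite opprD addrA addrAC -polyCB coef_polyC_subX_exp.
  by rewrite mulrnAr mulrCA.
have coef_f l : f`_l =
    (-1) ^+ l * (\sum_i c i * a i ^+ (K + n - l)) *+ 'C(K + n, l)
    - (l == 0%N)%:R.
  rewrite -[f in LHS]comp_polyXr -['X in LHS]addr0 -polyC0 coef_shift.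
  by under eq_bigr => i _ do rewrite subr0.
(* Here the moment has order [n], so the coefficient is ['C(K + n, n)] up to sign; the constant [-1]
   does not interfere since [0 < K]. *)
have coefK : f`_K != 0.
  rewrite coef_f (gtn_eqF K_gt0) subr0 addKn cP // eqxx mulr1.
  rewrite -mulr_natr mulf_neq0 ?signr_eq0 //.
  by rewrite -[X in 'C(_, X)](addnK n) bin_sub ?leq_addl.
have f_neq0 : f != 0 by apply: contraNneq coefK => ->; rewrite coef0.
(* Beyond degree [K] the moments have order below [n] and vanish. *)
have size_f : (size f <= K.+1)%N.
  apply/leq_sizeP => l lt_Kl; rewrite coef_f gtn_eqF ?subr0; last by lia.
  have [l_le|l_gt] := leqP l (K + n); last by rewrite bin_small.
  by rewrite cP ?ltn_eqF ?mulr0 ?mul0rn //; lia.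
have dvd_f b : b \in enum B -> ('X - b%:P) ^+ (n + (b \notin A)) %| f.
  rewrite mem_enum => bB; apply: dvdp_XsubC_exp => l l_lt.
  have l_le : (l <= n)%N by case: (b \notin A) l_lt; lia.
  (* Once the [K]-th powers are dropped, the shifted moment of order [n - l] is 1 exactly at
     [l = 0], where it cancels the [-1]. *)
  rewrite coef_shift (eq_bigr (fun i => c i * (a i - b) ^+ (n - l))) => [|i _].
    rewrite (moment_weights_shift b cP) ?leq_subr //.
    case: l l_lt l_le => [|l] _ l_le; first by rewrite subn0 eqxx bin0 mul1r subrr.
    by rewrite ltn_eqF ?mulr0 ?mul0rn ?subr0 //; lia.
  congr (_ * _); rewrite -addnBA // exprD.
  (* If [a i = b], the two sides agree only for [l < n]; this costs the points of [A] one order of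
     vanishing. *)
  have [ab|ab] := eqVneq (a i - b) 0.
    have n_l : (0 < n - l)%N.
      have bA : b \in A by apply/imsetP; exists i => //; apply/esym/subr0_eq.
      by move: l_lt; rewrite bA /=; lia.
    by rewrite ab !expr0n (gtn_eqF K_gt0) (gtn_eqF n_l) mul0r.
  rewrite square_exp_half ?mul1r //.
  move/forall_inP: sqB; apply; apply/imset2P; exists (a i) b => //.
have := leq_trans (sum_multiplicities (enum_uniq B) f_neq0 dvd_f) size_f.
rewrite ltnS; apply: leq_trans.
(* The total is [n |B| + (|B| - (n + 1)) = (n + 1) (|B| - 1)]. *)
rewrite big_enum /= big_split /= sum_nat_const.
have -> : (\sum_(b in B) (b \notin A) = #|B| - n.+1)%N.
  rewrite -cardA -cardsDS // -sum1_card big_mkcond [RHS]big_mkcond /=.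
  by apply: eq_bigr => b _; rewrite inE; case: (b \in A); case: (b \in B).
move: n_lt; move: #|B| => N; nia.
Qed.

(** * Admissible values of [n] *)

Lemma half_odd_mul (a b : nat) : odd a -> ((a * b)./2 = a./2 * b + b./2)%N.
Proof.
move=> a_odd; rewrite -{1}(odd_double_half a) a_odd mulnDl mul1n -doubleMl addnC.
by rewrite halfD odd_double doubleK.
Qed.

(** Modulo [p], the factors of the falling factorial are [p./2 + d - i] with [i < d <= p./2], hence
    lie strictly between 0 and [p]. *)
Lemma ndvd_bin_half (p a d : nat) :
  prime p -> odd p -> odd a -> (d <= p./2)%N ->
  ~~ (p %| 'C((a * p)./2 + d, d))%N.
Proof.
move=> p_prime p_odd a_odd d_le; have p_gt1 := prime_gt1 p_prime.
have : ~~ (p %| ((a * p)./2 + d) ^_ d)%N.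
  rewrite ffact_prod Euclid_dvd_prod // big_has; apply/hasPn => i _ /=.
  have lt_id := ltn_ord i.
  rewrite half_odd_mul // -addnA -addnBA; last by lia.
  by rewrite dvdn_addr ?dvdn_mull // gtnNdvd //; lia.
by apply: contra; rewrite -bin_ffact => /dvdn_mulr.
Qed.

Lemma clique_bound (F : finFieldType) (B : {set F}) (p m d : nat) :
  prime p -> odd p -> #|F| = (p ^ m.*2.+1)%N -> square_diffs B ->
  (d <= p./2)%N -> (d * p ^ m < #|B|)%N ->
  ((d * p ^ m).+1 * #|B|.-1 <= #|F|.-1./2)%N.
Proof.
move=> p_prime p_odd cardF sqB d_le d_lt.
have pcharF := card_finPcharP cardF p_prime.
have P_odd : odd (p ^ m) by rewrite oddX p_odd orbT.
apply: clique_stepanov => //; first by rewrite cardF oddX p_odd orbT.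
(* Division by [p ^ m] with remainder [(p ^ m)./2], so that [lucas_step] leaves the binomial of
   [ndvd_bin_half] with [a = p ^ m]. *)
have -> : (#|F|.-1./2 + d * p ^ m =
    ((p ^ m * p)./2 + d) * p ^ m + (p ^ m)./2)%N.
  have -> : #|F|.-1./2 = #|F|./2.
    have : odd #|F| by rewrite cardF oddX p_odd orbT.
    by move: #|F| => N; lia.
  rewrite cardF expnS -addnn expnD; move: (p ^ m)%N P_odd => P P_odd.
  rewrite mulnA [(p * _)%N]mulnC [in LHS]half_odd_mul ?oddM ?P_odd //.
  by rewrite mulnDl addnAC.
rewrite lucas_step; last 2 first.
- by rewrite (eq_pnat _ (pcharf_eq pcharF)) pnatX pnat_id.
- by have := odd_gt0 P_odd; lia.
by rewrite -(dvdn_pcharf pcharF) ndvd_bin_half.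
Qed.

(** * Bounds on the size of [B] *)

Lemma sqrt_bracket (n : nat) :
  (0 < n)%N -> exists d, (d * d < n <= d.+1 * d.+1)%N.
Proof.
elim: n => // -[_ _|n IHn _]; first by exists 0%N.
have [d /andP[lo hi]] := IHn isT.
have [n_le|n_gt] := leqP n.+2 (d.+1 * d.+1); first by exists d; lia.
by exists d.+1; nia.
Qed.

Lemma clique_card_prime (F : finFieldType) (B : {set F}) (p : nat) :
  prime p -> odd p -> #|F| = p -> square_diffs B ->
  (2 * #|B| * #|B|.-1 < p)%N.
Proof.
move=> p_prime p_odd cardF sqB; have p_gt1 := prime_gt1 p_prime.
have [B0|B_gt0] := posnP #|B|; first by rewrite B0; lia.
have bound d : (d <= p./2)%N -> (d < #|B|)%N -> (d.+1 * #|B|.-1 <= p.-1./2)%N.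
  move=> d_le d_lt; have := @clique_bound F B p 0 d p_prime p_odd.
  by rewrite expn0 muln1 -cardF expn1; apply; rewrite // cardF.
(* The choice [d = |B| - 1] gives the bound; if it is too large, [d = p./2] gives a
   contradiction. *)
have [B_le|B_gt] := leqP #|B|.-1 p./2.
  by have := bound _ B_le; rewrite prednK // => /(_ (leqnn _)); nia.
by have := bound _ (leqnn _); nia.
Qed.

Lemma clique_card_prime_power (F : finFieldType) (B : {set F}) (p m : nat) :
  prime p -> p = 1 %[mod 4] -> #|F| = (p ^ m.+1.*2.+1)%N -> square_diffs B ->
  (#|B|.+1 ^ 2 <= #|F|)%N.
Proof.
move=> p_prime p_mod4 cardF sqB; have p_gt1 := prime_gt1 p_prime.
have p_ge5 : (5 <= p)%N by lia.
(* For [d = 2], the bound [p <= 9] must be sharpened to [p <= 2 d^2 = 8]. *)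
have p_neq9 : p <> 9 by move=> p9; move: p_prime; rewrite p9.
have p_odd : odd p by lia.
have [d /andP[lo hi]] := sqrt_bracket (ltnW p_gt1).
have d_ge2 : (2 <= d)%N by nia.
have d_le : (d <= p./2)%N by nia.
have hi2 : (p <= 2 * (d * d))%N.
  have [d2|d_ge3] : d = 2%N \/ (3 <= d)%N by lia.
    by move: hi; rewrite d2; lia.
  nia.
have P_ge : (p <= p ^ m.+1)%N by rewrite expnS leq_pmulr // expn_gt0; lia.
have := @clique_bound F B p m.+1 d p_prime p_odd cardF sqB d_le.
have cardE : #|F| = (p * (p ^ m.+1 * p ^ m.+1))%N.
  by rewrite cardF expnS -addnn expnD.
rewrite cardE.
move: (p ^ m.+1)%N P_ge => P P_ge bound.
have [B_le|B_gt] := leqP #|B| (d * P).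
  (* [(dP + 1)^2 <= (d^2 + 1) P^2 <= p P^2], since [2 d <= d^2 < p <= P]. *)
  rewrite (@leq_trans ((d * P).+1 ^ 2)) ?leq_exp2r //.
  have : (2 * d <= P)%N by nia.
  nia.
(* With [D = dP < |B|], this yields [2 D (D + 1) < q <= 2 D^2], which is absurd. *)
have qP_le : (p * (P * P) <= 2 * (d * P * (d * P)))%N.
  by rewrite mulnACA [leqRHS]mulnA leq_mul2r hi2 orbT.
have dP_gt0 : (0 < d * P)%N by rewrite muln_gt0; lia.
have dP_le : ((d * P).+1 * (d * P) <= (p * (P * P)).-1./2)%N.
  by apply: leq_trans (bound B_gt); rewrite leq_pmul2l //; lia.
move: dP_le qP_le dP_gt0; rewrite mulSn.
by move: (p * (P * P))%N (d * P)%N => N D; move: (D * D)%N => DD; lia.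
Qed.

(** * Integer square root and conclusion *)

Lemma floor_sqrt_eq (R : realType) (n d : nat) :
  (d ^ 2 <= n < d.+1 ^ 2)%N -> floor_sqrt R n = d.
Proof.
move=> /andP[lo hi]; apply: truncn_def.
have sqrtE m : m%:R = Num.sqrt ((m ^ 2)%:R : R).
  by rewrite natrX sqrtr_sqr ger0_norm.
rewrite (sqrtE d) (sqrtE d.+1) ler_sqrt ?ler0n // ltr_sqrt ?ltr0n ?expn_gt0 //.
by rewrite ler_nat ltr_nat lo hi.
Qed.

Theorem theorem1 (R : realType) (p k q : nat) (F : finFieldType)
  (p_prime : prime p) (k_odd : odd k) (q_def : q = (p ^ k)%N)
  (q_mod4 : q = 1 %[mod 4]) (F_card : #|F| = q) :
  let s : int := (max_square_diffs F)%:Z in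
  (~~ odd (floor_sqrt R q) -> s ^+ 2 + s - 1 <= q%:Z) /\
  (odd (floor_sqrt R q) -> s ^+ 2 + 2 * s - 2 <= q%:Z).
Proof.
have set0_ok : (0 < #|[pred B : {set F} | square_diffs B]|)%N.
  apply/card_gt0P; exists set0; rewrite inE; apply/forall_inP => x.
  by case/imset2P => b1 b2; rewrite inE.
have [B sqB maxE] := eq_bigmax_cond (fun B : {set F} => #|B|) set0_ok.
rewrite /max_square_diffs maxE => {maxE set0_ok}.
rewrite inE in sqB; have p_gt1 := prime_gt1 p_prime.
have [m kE] : exists m, k = m.*2.+1.
  by exists k./2; have := odd_double_half k; rewrite k_odd.
have p_odd : odd p.
  have : odd q by lia.
  by rewrite q_def kE oddX.
(* [q] is [p] times an odd square, and odd squares are 1 modulo 4. *)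
have p_mod4 : p = 1 %[mod 4].
  have : q = (p * (p ^ m) ^ 2)%N by rewrite q_def kE expnS -muln2 expnM.
  have : odd (p ^ m) by rewrite oddX p_odd orbT.
  move: (p ^ m)%N => P P_odd qE.
  have : P ^ 2 = 1 %[mod 4].
    by rewrite -modnXm; have [->|->] : (P %% 4 = 1 \/ P %% 4 = 3)%N by lia.
  move: q_mod4; rewrite qE -modnMmr => + P2.
  by rewrite P2 modnMmr muln1.
case: m kE => [|m] kE.
  have pE : p = q by rewrite q_def kE expn1.
  have B_le : (2 * #|B| * #|B|.-1 < q)%N.
    by rewrite -pE clique_card_prime // F_card.
  have floor5 : q = 5 -> floor_sqrt R q = 2 by move=> ->; apply: floor_sqrt_eq.
  have q_neq2 : q <> 2 by lia.
  (* From [2 s (s - 1) + 1 <= q], (i) follows by [(s - 1) (s - 2) >= 0], and (ii) by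
     [(s - 1) (s - 3) >= 0] unless [s = 2], where [q >= 6] is required. *)
  move: B_le; move: #|B| => s B_le.
  split=> floor_parity; first by nia.
  have q_neq5 : q <> 5 by move=> q5; rewrite floor5 in floor_parity.
  have [s2|s_neq2] := eqVneq s 2%N; first by rewrite s2; lia.
  nia.
have cardF : #|F| = (p ^ m.+1.*2.+1)%N by rewrite F_card q_def kE.
have := clique_card_prime_power p_prime p_mod4 cardF sqB.
rewrite F_card; move: #|B| => s s_le.
by split=> _; nia.
Qed.
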